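(* Let $\mu\in[\mu_0,\delta^{-1}]$. If there exists a global maximizer $(\varsigma_\mu,\sigma_\mu)\in\mathcal S_\mu^+$ of $P_\mu^d(\varsigma,\sigma)$ over $\mathcal S_\mu^+$, then the vector $$x_\mu=G_\mu(\varsigma_\mu,\sigma_\mu)^{-1}(f-\sigma_\mu b)$$ is a global minimizer of $P_\mu$ over $\mathcal X_\mu$ (in particular $x_\mu\in\mathcal X_\mu$), and $$P_\mu^d(\varsigma,\sigma)\le P_\mu(x)\qquad\text{for all }(x,\varsigma,\sigma)\in\mathcal X_\mu\times\mathcal S_\mu^+ .$$
   Context: Data: $n,m\ge 1$; $B\in\mathbb R^{m\times n}$; $Q\in\mathbb R^{n\times n}$ symmetric; $H\in\mathbb R^{n\times n}$ (symmetric) negative definite; $\lambda\in\mathbb R$, $\lambda>0$; $f,b\in\mathbb R^n$. $|\cdot|$ is the Euclidean norm. Define $$g(x)=\tfrac12\left(\tfrac12|Bx|^2-\lambda\right)^2,\qquad h(x)=\tfrac12x^THx-b^Tx,\qquad x\in\mathbb R^n .$$ Assume $h(H^{-1}b)>0$, define $\mu_0>0$ by $\mu_0^{-1}=h(H^{-1}b)$, and fix $\delta\in(0,\mu_0^{-1}]$. For $\mu\in[\mu_0,\delta^{-1}]$ let $$\mathcal X_\mu=\{x\in\mathbb R^n: h(x)\ge\mu^{-1}\},\qquad P_\mu(x)=\tfrac12x^TQx-f^Tx+\mu g(x),$$ $$G_\mu(\varsigma,\sigma)=Q+\mu\varsigma B^TB-\sigma H,\qquad \mathcal S_\mu^+=\{(\varsigma,\sigma)\in\mathbb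 R^2:\varsigma\ge-\lambda,\ \sigma\ge0,\ G_\mu(\varsigma,\sigma)\succ0\},$$ where $\succ0$ means positive definite, and for $(\varsigma,\sigma)\in\mathcal S_\mu^+$ let $$P_\mu^d(\varsigma,\sigma)=-\tfrac12(f-\sigma b)^TG_\mu(\varsigma,\sigma)^{-1}(f-\sigma b)-\mu\lambda\varsigma-\tfrac{\mu}{2}\varsigma^2+\tfrac{\sigma}{\mu}.$$ *)

(* Defs.v *)
From HB Require Import structures.
From mathcomp Require Import all_boot all_order all_algebra.
From mathcomp Require Import classical_sets reals.

Set Implicit Arguments.
Unset Strict Implicit.
Unset Printing Implicit Defensive.

Import Order.TTheory GRing.Theory Num.Theory.

Local Open Scope classical_set_scope.
Local Open Scope ring_scope.

Definition vdot (R : realType) (n : nat) (u v : 'cV[R]_n) : R :=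
  (u^T *m v) 0 0.

Definition qform (R : realType) (n : nat) (A : 'M[R]_n) (x : 'cV[R]_n) : R :=
  (x^T *m A *m x) 0 0.

(* The canonical norm [`|x|] that MathComp-Analysis puts on matrices is the
   sup norm, hence this explicit Euclidean norm. *)
Definition enorm (R : realType) (n : nat) (x : 'cV[R]_n) : R :=
  Num.sqrt (\sum_(i < n) x i 0 ^+ 2).

Definition posdef (R : realType) (n : nat) (A : 'M[R]_n) : Prop :=
  A^T = A /\ forall x : 'cV[R]_n, x != 0 -> 0 < qform A x.

Definition negdef (R : realType) (n : nat) (A : 'M[R]_n) : Prop :=
  A^T = A /\ forall x : 'cV[R]_n, x != 0 -> qform A x < 0.

Definition global_minimizer (R : realType) (T : Type) (F : T -> R)
    (A : set T) (x : T) : Prop :=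
  A x /\ forall y, A y -> F x <= F y.

Definition global_maximizer (R : realType) (T : Type) (F : T -> R)
    (A : set T) (x : T) : Prop :=
  A x /\ forall y, A y -> F y <= F x.

Definition gfun (R : realType) (n m : nat) (B : 'M[R]_(m, n)) (lambda : R)
    (x : 'cV[R]_n) : R :=
  2^-1 * (2^-1 * enorm (B *m x) ^+ 2 - lambda) ^+ 2.

Definition hfun (R : realType) (n : nat) (H : 'M[R]_n) (b x : 'cV[R]_n) : R :=
  2^-1 * qform H x - vdot b x.

Definition Xset (R : realType) (n : nat) (H : 'M[R]_n) (b : 'cV[R]_n)
    (mu : R) : set 'cV[R]_n :=
  [set x | mu^-1 <= hfun H b x].

Definition Pprimal (R : realType) (n m : nat) (B : 'M[R]_(m, n)) (Q : 'M[R]_n)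
    (lambda : R) (f : 'cV[R]_n) (mu : R) (x : 'cV[R]_n) : R :=
  2^-1 * qform Q x - vdot f x + mu * gfun B lambda x.

Definition Gmx (R : realType) (n m : nat) (B : 'M[R]_(m, n)) (Q H : 'M[R]_n)
    (mu : R) (p : R * R) : 'M[R]_n :=
  Q + (mu * p.1) *: (B^T *m B) - p.2 *: H.

Definition Splus (R : realType) (n m : nat) (B : 'M[R]_(m, n)) (Q H : 'M[R]_n)
    (lambda mu : R) : set (R * R) :=
  [set p | [/\ - lambda <= p.1, 0 <= p.2 & posdef (Gmx B Q H mu p)]].

(* [invmx A] is [A] when [A] is singular; on [Splus] the matrix [Gmx] is
   positive definite, so there it is the true inverse. *)
Definition Pdual (R : realType) (n m : nat) (B : 'M[R]_(m, n)) (Q H : 'M[R]_n)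
    (lambda : R) (f b : 'cV[R]_n) (mu : R) (p : R * R) : R :=
  - 2^-1 * qform (invmx (Gmx B Q H mu p)) (f - p.2 *: b)
  - mu * lambda * p.1 - mu / 2 * p.1 ^+ 2 + p.2 / mu.

(* Main.v *)
(* Weak duality comes from the Lagrangian
     L(x, s, t) = 1/2 x^T G(s, t) x - (f - t b)^T x - mu lambda s - mu/2 s^2 + t / mu,
   whose minimum over x is the dual function and which is bounded by the primal
   function on the feasible set. Strong duality at a dual maximizer follows from
   the variational inequality of the dual problem: the dual function has a
   first-order lower expansion along every segment issued from the maximizer, and
   its gradient there is (mu (1/2 |B x|^2 - lambda - s), 1 / mu - h(x)).
   Testing it with s' = 1/2 |B x|^2 - lambda, which is always admissible since
   s' >= - lambda, forces s = s'; testing it with t + 1 and with 0 gives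
   feasibility of x and complementary slackness. *)
Require Import Defs.
From HB Require Import structures.
From mathcomp Require Import all_boot all_order all_algebra.
From mathcomp Require Import classical_sets reals.
From mathcomp Require Import ring lra.

Set Implicit Arguments.
Unset Strict Implicit.
Unset Printing Implicit Defensive.

Import Order.TTheory GRing.Theory Num.Theory.

Local Open Scope classical_set_scope.
Local Open Scope ring_scope.

(** * Inner products and quadratic forms *)

Section VdotTheory.
Variables (R : realType) (n : nat).
Implicit Types (u v w x : 'cV[R]_n) (A G E : 'M[R]_n) (t : R).

Lemma vdotE u v : vdot u v = \sum_i u i 0 * v i 0.
Proof. by rewrite /vdot mxE; apply: eq_bigr => i _; rewrite mxE. Qed.

Lemma vdotC u v : vdot u v = vdot v u.
Proof. by rewrite !vdotE; apply: eq_bigr => i _; rewrite mulrC. Qed.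

Lemma vdotDr u v w : vdot u (v + w) = vdot u v + vdot u w.
Proof. by rewrite /vdot mulmxDr mxE. Qed.

Lemma vdotZr t u v : vdot u (t *: v) = t * vdot u v.
Proof. by rewrite /vdot -scalemxAr mxE. Qed.

Lemma vdotNr u v : vdot u (- v) = - vdot u v.
Proof. by rewrite -scaleN1r vdotZr mulN1r. Qed.

Lemma vdotDl u v w : vdot (u + v) w = vdot u w + vdot v w.
Proof. by rewrite ![vdot _ w]vdotC vdotDr. Qed.

Lemma vdotZl t u v : vdot (t *: u) v = t * vdot u v.
Proof. by rewrite ![vdot _ v]vdotC vdotZr. Qed.

Lemma vdotNl u v : vdot (- u) v = - vdot u v.
Proof. by rewrite ![vdot _ v]vdotC vdotNr. Qed.

Lemma vdot_mul_symm A u v : A^T = A -> vdot u (A *m v) = vdot (A *m u) v.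
Proof. by move=> sA; rewrite /vdot trmx_mul sA mulmxA. Qed.

Lemma qformE A x : qform A x = vdot x (A *m x).
Proof. by rewrite /qform /vdot mulmxA. Qed.

Lemma qformDl A G x : qform (A + G) x = qform A x + qform G x.
Proof. by rewrite !qformE mulmxDl vdotDr. Qed.

Lemma qformZl t A x : qform (t *: A) x = t * qform A x.
Proof. by rewrite !qformE -scalemxAl vdotZr. Qed.

Lemma qformNl A x : qform (- A) x = - qform A x.
Proof. by rewrite -scaleN1r qformZl mulN1r. Qed.

Lemma qform_sum A x : qform A x = \sum_i \sum_j x i 0 * A i j * x j 0.
Proof.
rewrite qformE vdotE; apply: eq_bigr => i _; rewrite mxE mulr_sumr.
by apply: eq_bigr => j _; rewrite mulrA.
Qed.

(** * Positive definite matrices and perturbation of their inverses *)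

Lemma posdef_qform_ge0 G x : posdef G -> 0 <= qform G x.
Proof.
case=> _ pG; have [->|/pG/ltW//] := eqVneq x 0.
by rewrite qformE mulmx0 vdotE big1 // => i _; rewrite mxE mul0r.
Qed.

Lemma posdef_unitmx G : posdef G -> G \in unitmx.
Proof.
case=> sG pG; rewrite unitmxE unitfE; apply/det0P => -[v v0 vG].
have vT0 : v^T != 0 by rewrite -(inj_eq trmx_inj) trmxK trmx0.
by have := pG _ vT0; rewrite /qform trmxK vG mul0mx mxE ltxx.
Qed.

Lemma posdef_mulKV G x : posdef G -> G *m (invmx G *m x) = x.
Proof. by move=> pG; rewrite mulKVmx // posdef_unitmx. Qed.

(** Cauchy-Schwarz for the inner product of [G]: with [w] the solution of [G w = e_i], the
    coordinate [x_i] is the [G]-product of [w] and [x], and [k] is the [G]-square of [w]. *)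
Lemma posdef_sqr_coord G (i : 'I_n) : posdef G ->
  exists2 k, 0 <= k & forall x, x i 0 ^+ 2 <= k * qform G x.
Proof.
move=> pG; have [sG _] := pG.
pose e : 'cV[R]_n := delta_mx i 0; pose w := invmx G *m e.
have Gw : G *m w = e by exact: posdef_mulKV.
have eE x : vdot e x = x i 0.
  rewrite vdotE (bigD1 i) //= big1 => [|j /negbTE ji].
    by rewrite mxE !eqxx mul1r addr0.
  by rewrite mxE ji mul0r.
have w_gt0 : 0 < vdot e w.
  have [_ posG] := pG; rewrite -Gw -(vdot_mul_symm _ _ sG) -qformE.
  apply: posG; apply/eqP => w0; move: Gw; rewrite w0 mulmx0.
  by move/matrixP/(_ i 0)/eqP; rewrite !mxE !eqxx eq_sym oner_eq0.
exists (vdot e w); first exact: ltW.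
(* The vector is [x] minus its [G]-orthogonal projection onto [w]. *)
move=> x; have := posdef_qform_ge0 (x - (x i 0 / vdot e w) *: w) pG.
have -> : qform G (x - (x i 0 / vdot e w) *: w)
          = qform G x - x i 0 ^+ 2 / vdot e w.
  rewrite !qformE mulmxBr -scalemxAr Gw.
  rewrite vdotDl !vdotDr !vdotNr !vdotNl !vdotZr !vdotZl.
  rewrite (vdot_mul_symm w x sG) Gw [vdot x e]vdotC [vdot w e]vdotC !eE.
  by field; rewrite -eE gt_eqF.
by rewrite subr_ge0 ler_pdivrMr // mulrC.
Qed.

(** The form of [E] is expanded into its entries; each product [x_i x_j] is at most [x_i^2 + x_j^2]
    in absolute value, and the coordinate bounds apply. *)
Lemma posdef_dominates G E : posdef G ->
  exists2 C, 0 <= C & forall x, `|qform E x| <= C * qform G x.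
Proof.
move=> pG.
have /fin_all_exists [k kP] (i : 'I_n) :
    exists k, 0 <= k /\ forall x, x i 0 ^+ 2 <= k * qform G x.
  by have [k k0 kP] := posdef_sqr_coord i pG; exists k.
exists (\sum_i \sum_j `|E i j| * (k i + k j)).
  apply: sumr_ge0 => i _; apply: sumr_ge0 => j _.
  by rewrite mulr_ge0 // addr_ge0 //; [case: (kP i)|case: (kP j)].
move=> x; rewrite qform_sum mulr_suml.
apply: le_trans (ler_norm_sum _ _ _) _; apply: ler_sum => i _.
rewrite mulr_suml; apply: le_trans (ler_norm_sum _ _ _) _.
apply: ler_sum => j _; rewrite !normrM.
have [_ /(_ x)] := kP i; have [_ /(_ x)] := kP j.
rewrite -[x j 0 ^+ 2]real_normK ?num_real// -[x i 0 ^+ 2]real_normK ?num_real//.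
move: `|x i 0| `|x j 0| (normr_ge0 (E i j)) => a c E0 hc ha.
rewrite mulrAC mulrC -mulrA ler_wpM2l //.
have := sqr_ge0 (a - c); have := sqr_ge0 (a + c).
by rewrite mulrDl; nra.
Qed.

(** Inversion reverses the order of positive definite forms. With [G' z = r] and [G w = r], expand
    the nonnegative [G]-square of [z - k w] and bound the [G]-square of [z] by [k z^T r]. *)
Lemma qform_invmx_le G G' (k : R) r : posdef G -> posdef G' -> 0 < k ->
  (forall x, qform G x <= k * qform G' x) ->
  qform (invmx G') r <= k * qform (invmx G) r.
Proof.
move=> pG pG' k0 leGG'; have [sG _] := pG.
rewrite [X in X <= _]qformE [qform _ r]qformE.
set z := invmx G' *m r; set w := invmx G *m r.
have G'z : G' *m z = r by exact: posdef_mulKV.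
have Gw : G *m w = r by exact: posdef_mulKV.
have := posdef_qform_ge0 (z - k *: w) pG; have := leGG' z.
rewrite !qformE G'z mulmxBr -scalemxAr Gw.
rewrite vdotDl !vdotDr !vdotNr !vdotNl !vdotZr !vdotZl.
rewrite (vdot_mul_symm w z sG) Gw [vdot z r]vdotC [vdot w r]vdotC.
move: (vdot z _) (vdot r z) (vdot r w) => a c d h1 h2.
by rewrite -(ler_pM2l k0); lra.
Qed.

Lemma posdef_perturb G E : posdef G -> E^T = E ->
  exists2 t0, 0 < t0 & forall t, 0 <= t <= t0 ->
    posdef (G + t *: E) /\ forall x, qform G x <= 2 * qform (G + t *: E) x.
Proof.
move=> pG sE; have [sG posG] := pG; have [C C0 CP] := posdef_dominates E pG.
(* For such [t] the form of [t E] is at most half that of [G]; [C + 1] keeps the bound meaningful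
   when [C = 0]. *)
exists (2 * (C + 1))^-1; first by rewrite invr_gt0; lra.
move=> t /andP[t0 tle].
have tC : t * (2 * (C + 1)) <= 1 by rewrite -ler_pdivlMr ?div1r //; lra.
have le2 x : qform G x <= 2 * qform (G + t *: E) x.
  rewrite qformDl qformZl.
  have q0 := posdef_qform_ge0 x pG.
  have := CP x; rewrite ler_norml => /andP[lo _].
  have h1 : t * - (C * qform G x) <= t * qform E x by rewrite ler_wpM2l.
  have h2 : t * (2 * (C + 1)) * qform G x <= 1 * qform G x by rewrite ler_wpM2r.
  have h3 := mulr_ge0 t0 q0.
  by lra.
split=> //; split; first by rewrite linearD linearZ /= sG sE.
by move=> x /posG; have := le2 x; lra.
Qed.

(* With r = e - E x and z the solution of (G + t E) z = r, the solution of
   (G + t E) y = c + t e is y = x + t z, so the second-order remainder is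
   exactly t^2 z^T r. *)
Lemma qform_invmx_expansion G E c e (x := invmx G *m c) :
  posdef G -> E^T = E ->
  exists2 t0, 0 < t0 & exists K, forall t, 0 <= t <= t0 ->
    posdef (G + t *: E) /\
    qform (invmx (G + t *: E)) (c + t *: e)
      <= qform (invmx G) c - t * (qform E x - 2 * vdot e x) + t ^+ 2 * K.
Proof.
move=> pG sE; have [t0 t0_gt0 pert] := posdef_perturb pG sE.
have Gx : G *m x = c by exact: posdef_mulKV.
pose r := e - E *m x.
(* This [K] bounds [z^T r] uniformly in [t], because [G] is at most twice [G + t E]. *)
exists t0 => //; exists (2 * qform (invmx G) r) => t /pert[pG' le2].
split=> //; have := qform_invmx_le r pG pG' (ltr0Sn R 1) le2.
rewrite [qform (invmx (_ + _)) r]qformE; set G' := G + t *: E.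
set z := invmx G' *m r => zr.
have G'z : G' *m z = r by exact: posdef_mulKV.
have [sG' _] := pG'.
have G'y : G' *m (x + t *: z) = c + t *: e.
  rewrite mulmxDr -scalemxAr G'z mulmxDl Gx -scalemxAl -addrA -scalerDr.
  by rewrite /r [E *m x + _]addrC subrK.
have yr : vdot (c + t *: e) z = vdot x r + t * vdot r z.
  by rewrite -G'y -(vdot_mul_symm _ _ sG') G'z vdotDl vdotZl [vdot z r]vdotC.
have xr : vdot x r = vdot e x - qform E x.
  by rewrite /r vdotDr vdotNr -qformE vdotC.
have -> : qform (invmx G') (c + t *: e)
          = qform (invmx G) c - t * (qform E x - 2 * vdot e x)
            + t ^+ 2 * vdot r z.
  rewrite [X in X = _]qformE.
  have -> : invmx G' *m (c + t *: e) = x + t *: z.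
    by rewrite -G'y mulKmx // posdef_unitmx.
  rewrite vdotDr vdotZr yr xr vdotDl vdotZl.
  by rewrite [qform (invmx G) c]qformE -/x; ring.
by rewrite lerD2l ler_wpM2l ?sqr_ge0.
Qed.

End VdotTheory.

Lemma le0_linear_le_quadratic (R : realType) (a K t0 : R) : 0 < t0 ->
  (forall t, 0 < t <= t0 -> t * a <= t ^+ 2 * K) -> a <= 0.
Proof.
move=> t0_gt0 le_aK; rewrite leNgt; apply/negP => a_gt0.
have K_gt0 : 0 < `|K| + 1 by rewrite ltr_wpDl.
(* Small enough that [t K <= a / 2 < a], which contradicts the assumed inequality divided by [t]. *)
pose t := Num.min t0 (a / 2 / (`|K| + 1)).
have t_gt0 : 0 < t by rewrite lt_min t0_gt0 !divr_gt0.
have tK : t * (`|K| + 1) <= a / 2 by rewrite -ler_pdivlMr // ge_min lexx orbT.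
have := le_aK t; rewrite t_gt0 ge_min lexx => /(_ isT).
rewrite expr2 -mulrA ler_pM2l // leNgt => /negP; apply.
have : t * K <= t * `|K| by rewrite ler_pM2l // ler_norm.
by lra.
Qed.

(** * The Lagrangian, weak duality and the variational inequality *)

Section Duality.
Variables (R : realType) (n m : nat) (B : 'M[R]_(m, n)) (Q H : 'M[R]_n).
Variables (lambda : R) (f b : 'cV[R]_n) (mu : R).
Hypotheses (sH : H^T = H) (mu_gt0 : 0 < mu).

Local Notation G := (Gmx B Q H mu).
Local Notation Pd := (Pdual B Q H lambda f b mu).
Local Notation S := (Splus B Q H lambda mu).

Let xmin (p : R * R) := invmx (G p) *m (f - p.2 *: b).

Lemma enorm_sqr (k : nat) (x : 'cV[R]_k) : enorm x ^+ 2 = vdot x x.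
Proof.
rewrite sqr_sqrtr; last by apply: sumr_ge0 => i _; apply: sqr_ge0.
by rewrite vdotE; apply: eq_bigr => i _; rewrite expr2.
Qed.

Lemma qform_gram x : qform (B^T *m B) x = enorm (B *m x) ^+ 2.
Proof. by rewrite enorm_sqr /qform /vdot trmx_mul !mulmxA. Qed.

Definition lagrangian (x : 'cV[R]_n) (p : R * R) : R :=
  2^-1 * qform (G p) x - vdot (f - p.2 *: b) x
  - mu * lambda * p.1 - mu / 2 * p.1 ^+ 2 + p.2 / mu.

(** Completing the square in [p.1]: with [u = 1/2 |B x|^2 - lambda], one has
    [u s - s^2 / 2 = u^2 / 2 - (u - s)^2 / 2]. *)
Lemma lagrangianE x p :
  lagrangian x p = Pprimal B Q lambda f mu x
    - mu / 2 * (2^-1 * enorm (B *m x) ^+ 2 - lambda - p.1) ^+ 2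
    + p.2 * (mu^-1 - hfun H b x).
Proof.
rewrite /lagrangian /Pprimal /gfun /hfun /Gmx !qformDl qformNl !qformZl.
by rewrite qform_gram vdotDl vdotNl vdotZl; field; rewrite gt_eqF.
Qed.

(** The gap is half the [G p]-square of [x - xmin p]. *)
Lemma lagrangian_min x p : posdef (G p) -> Pd p <= lagrangian x p.
Proof.
move=> pG; have [sG _] := pG; rewrite /Pdual /lagrangian -/(xmin p).
have := posdef_qform_ge0 (x - xmin p) pG.
rewrite !qformE; set c := f - _; have Gx : G p *m xmin p = c.
  exact: posdef_mulKV.
rewrite mulmxBr Gx vdotDl !vdotDr !vdotNr !vdotNl.
rewrite (vdot_mul_symm (xmin p) x sG) Gx -/(xmin p) [vdot x c]vdotC.
by rewrite [vdot (xmin p) c]vdotC; lra.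
Qed.

Lemma lagrangian_xmin p : posdef (G p) -> lagrangian (xmin p) p = Pd p.
Proof.
move=> pG; rewrite /Pdual /lagrangian !qformE posdef_mulKV //.
by rewrite [vdot (xmin p) _]vdotC -/(xmin p); field; rewrite gt_eqF.
Qed.

Lemma weak_duality x p : Xset H b mu x -> S p ->
  Pd p <= Pprimal B Q lambda f mu x.
Proof.
move=> hx [_ p2_ge0 /(lagrangian_min x)/le_trans]; apply.
rewrite lagrangianE.
have : 0 <= mu / 2 * (2^-1 * enorm (B *m x) ^+ 2 - lambda - p.1) ^+ 2.
  by rewrite mulr_ge0 ?sqr_ge0 // divr_ge0 // ltW.
have : 0 <= p.2 * (hfun H b x - mu^-1) by rewrite mulr_ge0 // subr_ge0.
lra.
Qed.

(** The point [q] obeys only the two sign constraints: positive definiteness is an open condition,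
    so a short initial piece of the segment from [p] to [q] stays in [S]. This leaves the later test
    points free. *)
Lemma dual_variational p q : global_maximizer Pd S p ->
  - lambda <= q.1 -> 0 <= q.2 ->
  (q.1 - p.1)
    * (mu * (2^-1 * enorm (B *m xmin p) ^+ 2 - lambda - p.1))
  + (q.2 - p.2) * (mu^-1 - hfun H b (xmin p)) <= 0.
Proof.
move=> [[p1 p2 pG] pmax] q1 q2; set x := xmin p.
pose d := (q.1 - p.1, q.2 - p.2).
pose E := (mu * d.1) *: (B^T *m B) - d.2 *: H.
have sE : E^T = E.
  by rewrite /E linearB 2!linearZ /= trmx_mul trmxK sH.
have [t0 t0_gt0 [K expand]] :=
  qform_invmx_expansion (f - p.2 *: b) (- d.2 *: b) pG sE.
(* The cap [t <= 1] makes the points of the segment convex combinations, which preserves the sign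
   constraints. *)
pose t1 := Num.min t0 1.
have t1_gt0 : 0 < t1 by rewrite lt_min t0_gt0 ltr01.
(* The second-order constant collects half the remainder of the inverse form and the contribution of
   [- mu / 2 * p.1 ^+ 2]. *)
apply: (@le0_linear_le_quadratic _ _ (K / 2 + mu / 2 * d.1 ^+ 2) t1 t1_gt0).
move=> t /andP[t_gt0]; rewrite le_min => /andP[t_le t_le1].
have /expand[] : 0 <= t <= t0 by rewrite ltW.
pose pt := (p.1 + t * d.1, p.2 + t * d.2).
have -> : G p + t *: E = G pt.
  rewrite /Gmx /E /pt /=; move: (B^T *m B) => BB.
  by apply/matrixP => i j; rewrite !mxE; ring.
have -> : f - p.2 *: b + t *: (- d.2 *: b) = f - pt.2 *: b.
  by apply/matrixP => i j; rewrite /pt /= !mxE; ring.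
rewrite -/(xmin p) -/x => pGt le_t.
have /pmax : S pt.
  have t_le1' : 0 <= 1 - t by rewrite subr_ge0.
  split=> //=; rewrite /d /=.
    have : 0 <= (1 - t) * (p.1 + lambda) by rewrite mulr_ge0 //; lra.
    have : 0 <= t * (q.1 + lambda) by rewrite mulr_ge0 ?(ltW t_gt0) //; lra.
    lra.
  have : 0 <= (1 - t) * p.2 by rewrite mulr_ge0.
  have : 0 <= t * q.2 by rewrite mulr_ge0 // ltW.
  lra.
move: le_t; rewrite /Pdual /= /E qformDl qformNl !qformZl qform_gram vdotZl.
rewrite /hfun /d /=.
move: (qform (invmx (G p)) _) (qform (invmx (G pt)) _) => a c.
by lra.
Qed.

End Duality.

(** * Optimality conditions and strong duality at the dual maximizer *)

Theorem theorem1 (R : realType) (n m : nat) (hn : (1 <= n)%N) (hm : (1 <= m)%N)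
    (B : 'M[R]_(m, n)) (Q H : 'M[R]_n) (lambda : R) (f b : 'cV[R]_n)
    (hQ : Q^T = Q) (hH : negdef H) (hlambda : 0 < lambda)
    (hpos : 0 < hfun H b (invmx H *m b))
    (mu0 : R) (hmu0 : 0 < mu0) (mu0E : mu0^-1 = hfun H b (invmx H *m b))
    (delta : R) (hdelta : 0 < delta <= mu0^-1)
    (mu : R) (hmu : mu0 <= mu <= delta^-1)
    (varsigma_mu sigma_mu : R)
    (hmax : global_maximizer (Pdual B Q H lambda f b mu)
              (Splus B Q H lambda mu) (varsigma_mu, sigma_mu)) :
  let x_mu := invmx (Gmx B Q H mu (varsigma_mu, sigma_mu))
                *m (f - sigma_mu *: b) in
  global_minimizer (Pprimal B Q lambda f mu) (Xset H b mu) x_mu /\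
  (forall (x : 'cV[R]_n) (varsigma sigma : R),
     Xset H b mu x -> Splus B Q H lambda mu (varsigma, sigma) ->
     Pdual B Q H lambda f b mu (varsigma, sigma) <= Pprimal B Q lambda f mu x).
Proof.
move=> x_mu; have [sH _] := hH.
have mu_gt0 : 0 < mu by case/andP: hmu => + _; apply: lt_le_trans.
set p := (varsigma_mu, sigma_mu) in hmax x_mu *.
have [[/= varsigma_ge sigma_ge0 pG] _] := hmax.
have weak := @weak_duality _ _ _ B Q H lambda f b mu mu_gt0.
split; last by move=> x s t; apply: weak.
have vi := dual_variational sH hmax.
rewrite -/x_mu /= in vi.
have sqB : 0 <= enorm (B *m x_mu) ^+ 2 by rewrite sqr_ge0.
pose s := 2^-1 * enorm (B *m x_mu) ^+ 2 - lambda.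
have varsigmaE : s - varsigma_mu = 0.
  have s_ge : - lambda <= s by rewrite /s; lra.
  have /= := vi (s, sigma_mu) s_ge sigma_ge0.
  rewrite subrr mul0r addr0 mulrCA -expr2 pmulr_rle0 // => le0.
  by apply/eqP; rewrite -sqrf_eq0 eq_le sqr_ge0 le0.
have feas : mu^-1 - hfun H b x_mu <= 0.
  have /= := vi (varsigma_mu, sigma_mu + 1) varsigma_ge (addr_ge0 sigma_ge0 ler01).
  by lra.
have slack : sigma_mu * (mu^-1 - hfun H b x_mu) = 0.
  have /= := vi (varsigma_mu, 0) varsigma_ge (lexx 0).
  have := mulr_ge0_le0 sigma_ge0 feas.
  by lra.
(* By [varsigmaE] and [slack], both correction terms of [lagrangianE] vanish at [x_mu]. *)
have strong : Pprimal B Q lambda f mu x_mu = Pdual B Q H lambda f b mu p.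
  rewrite -(lagrangian_xmin lambda f b mu_gt0 pG) lagrangianE //.
  by rewrite -/x_mu /= -/s varsigmaE slack expr0n mulr0 subr0 addr0.
split=> [|y hy]; first by rewrite /Xset /= -subr_le0.
by rewrite strong; apply: weak.
Qed.
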